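(* Let $Y$ be a Banach space and $K$ a compact Hausdorff space, and suppose that $Y$ contains $C(K)$ (isometrically) as a closed subspace. Then the pair $(K,Y)$ has the continuous extension property if and only if there is a contractive projection from $Y$ onto $C(K)$.
   Context: $C(K)$ is the Banach space of continuous scalar functions on $K$ with the supremum norm, and for $t\in K$, $\delta_t\in C(K)^*$ is the Dirac functional $\delta_t(a)=a(t)$. The pair $(K,Y)$ has the continuous extension property if there is a map $\rho:K\to Y^*$, continuous for the weak-star topology of $Y^*$, such that for each $t\in K$ the functional $\rho(t)$ is a norm-preserving extension of $\delta_t$ to $Y$ (i.e. $\rho(t)|_{C(K)}=\delta_t$ and $\|\rho(t)\|=1$). A contractive projection from $Y$ onto $C(K)$ is a linear idempotent $P:Y\to Y$ with range $C(K)$ and $\|P\|\le 1$. *)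

(* Defs.v *)
From HB Require Import structures.
From mathcomp Require Import all_boot all_order all_algebra.
From mathcomp Require Import all_classical all_reals all_analysis.
From mathcomp Require Import complex.

Set Implicit Arguments.
Unset Strict Implicit.
Unset Printing Implicit Defensive.

Import Order.TTheory GRing.Theory Num.Theory.
Import numFieldNormedType.Exports.

Local Open Scope classical_set_scope.
Local Open Scope ring_scope.

Section ContinuousLmodule.
Context (T : topologicalType) (F : numFieldType) (V : normedModType F).
Local Notation C := (continuousType T V).
Implicit Types (f g h : C) (a b : F).

Let zero_cts : continuous (fun _ : T => 0 : V).
Proof. by move=> x; exact: cvg_cst. Qed.

Let opp_cts f : continuous (fun x => - f x).
Proof. by move=> x; apply: cvgN; exact: cts_fun. Qed.

Let add_cts f g : continuous (fun x => f x + g x).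
Proof. by move=> x; apply: cvgD; exact: cts_fun. Qed.

Let scale_cts a f : continuous (fun x => a *: f x).
Proof. by move=> x; apply: cvgZl_tmp; exact: cts_fun. Qed.

Definition cts_zero : C := mkcts zero_cts.
Definition cts_opp f : C := mkcts (@opp_cts f).
Definition cts_add f g : C := mkcts (@add_cts f g).
Definition cts_scale a f : C := mkcts (@scale_cts a f).

Let addA : associative cts_add.
Proof. by move=> f g h; apply/continuousEP => x; exact: addrA. Qed.

Let addC : commutative cts_add.
Proof. by move=> f g; apply/continuousEP => x; exact: addrC. Qed.

Let add0 : left_id cts_zero cts_add.
Proof. by move=> f; apply/continuousEP => x; exact: add0r. Qed.

Let addN : left_inverse cts_zero cts_opp cts_add.
Proof. by move=> f; apply/continuousEP => x; exact: addNr. Qed.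

HB.instance Definition _ := GRing.isZmodule.Build C addA addC add0 addN.

Let scaleA a b f : cts_scale a (cts_scale b f) = cts_scale (a * b) f.
Proof. by apply/continuousEP => x; exact: scalerA. Qed.

Let scale1 : left_id 1 cts_scale.
Proof. by move=> f; apply/continuousEP => x; exact: scale1r. Qed.

Let scaleDr : right_distributive cts_scale +%R.
Proof. by move=> a f g; apply/continuousEP => x; exact: scalerDr. Qed.

Let scaleDl f : {morph cts_scale^~ f : a b / a + b}.
Proof. by move=> a b; apply/continuousEP => x; exact: scalerDl. Qed.

HB.instance Definition _ :=
  GRing.Zmodule_isLmodule.Build F C scaleA scale1 scaleDr scaleDl.

End ContinuousLmodule.

Notation cfun K F := (continuousType K F^o).

(* The suprema below are taken in F itself, since norms over F are F-valued;
   for F = R[i] the order is the partial order in which z <= w means that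
   w - z is a nonnegative real, so the least upper bound of a nonempty bounded
   set of nonnegative reals is its usual supremum. *)
Definition supnorm (K : topologicalType) (F : numFieldType) (f : cfun K F) : F :=
  supremum 0 (range (fun t : K => `|f t|)).

#[short(type="boundedOperatorType")]
HB.structure Definition BoundedOperator (F : numFieldType)
    (V W : normedModType F) :=
  {f of @GRing.Linear F V W *:%R f & @Continuous V W f}.

Definition opnorm (F : numFieldType) (V W : normedModType F)
    (f : boundedOperatorType V W) : F :=
  supremum 0 [set `|f x| | x in [set x : V | `|x| <= 1]].

Definition dual (F : numFieldType) (Y : normedModType F) :=
  boundedOperatorType Y F^o.

Definition weak_star (F : numFieldType) (Y : normedModType F) : Type := dual Y.

Section WeakStarTopology.
Context (F : numFieldType) (Y : normedModType F).

Definition weak_star_eval (phi : weak_star Y) : {ptws Y -> F^o} :=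
  (phi : dual Y) : Y -> F^o.

HB.instance Definition _ := gen_eqMixin (weak_star Y).
HB.instance Definition _ := gen_choiceMixin (weak_star Y).
HB.instance Definition _ :=
  Topological.copy (weak_star Y) (initial_topology weak_star_eval).

End WeakStarTopology.

(* "Y contains C(K)" is rendered by an embedding j, so that the subspace C(K)
   of Y is range j, and j f is f seen as an element of Y. *)
Definition isometric_closed_embedding (F : numFieldType) (K : topologicalType)
    (Y : normedModType F) (j : {linear cfun K F -> Y}) : Prop :=
  (forall f, `|j f| = supnorm f) /\ closed (range j).

Definition continuous_extension_property (F : numFieldType)
    (K : topologicalType) (Y : normedModType F) (j : {linear cfun K F -> Y}) :=
  exists rho : K -> dual Y,
    continuous (rho : K -> weak_star Y) /\
    forall t : K, (forall f, rho t (j f) = f t) /\ opnorm (rho t) = 1.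

Definition contractive_projection_onto (F : numFieldType)
    (Y : normedModType F) (E : set Y) (P : boundedOperatorType Y Y) : Prop :=
  [/\ forall y, P (P y) = P y, range P = E & opnorm P <= 1].

(* Main.v *)
(** [rho] and [P] determine each other by [P y = j (t |-> rho t y)]: weak-star
    continuity of [rho] says exactly that [t |-> rho t y] is a continuous
    function on [K] for every [y], and [`|P y|] is the supremum of the
    [`|rho t y|]. The argument is the same over both scalar fields; it only uses
    that bounded sets of nonnegative scalars have suprema. *)
From HB Require Import structures.
Require Import Defs.
From mathcomp Require Import all_boot all_order all_algebra.
From mathcomp Require Import all_classical all_reals all_analysis.
From mathcomp Require Import complex.

Import Order.TTheory GRing.Theory Num.Theory.
Import numFieldNormedType.Exports.

Local Open Scope classical_set_scope.
Local Open Scope ring_scope.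

(** Nonnegativity confines the sets to real scalars, so that one condition fits both the total order
    of [R] and the partial order of [R[i]]. *)
Definition nneg_sup_complete (F : numFieldType) : Prop :=
  forall A : set F, A !=set0 -> (forall x, A x -> 0 <= x) ->
  ubound A !=set0 -> supremums A !=set0.

Lemma real_nneg_sup_complete (R : realType) : nneg_sup_complete R.
Proof.
move=> A A0 _ [M AM]; exists (sup A).
have hA : has_sup A by split=> //; exists M.
by split=> [x Ax|y yA]; [exact: ub_le_sup (proj2 hA) x Ax|exact: ge_sup].
Qed.

(** Nonnegative complex numbers are real and ordered by their real parts, so the supremum [sup B] of
    the real parts, put back into [R[i]], serves. *)
Lemma complex_nneg_sup_complete (R : realType) : nneg_sup_complete R[i].
Proof.
move=> A [a Aa] A_ge0 [M AM].
have leRe (z w : R[i]) :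
    0 <= z -> 0 <= w -> (z <= w) = (complex.Re z <= complex.Re w).
  by move=> /ger0_Im z0 /ger0_Im w0; rewrite lecE z0 w0 eqxx.
(* An upper bound dominates the nonnegative [a], so it too can be compared by real parts. *)
have ub_ge0 (z : R[i]) : ubound A z -> 0 <= z.
  by move=> /(_ _ Aa); exact: le_trans (A_ge0 _ Aa).
pose B := @complex.Re R @` A.
have hB : has_sup B.
  split; first by exists (complex.Re a), a.
  exists (complex.Re M) => _ [x Ax <-].
  by rewrite -leRe; [exact: AM|exact: A_ge0|exact: ub_ge0].
have Bub x : A x -> complex.Re x <= sup B.
  by move=> Ax; apply: ub_le_sup (proj2 hB) _ _; exists x.
have s0 : (0 : R[i]) <= (sup B)%:C%C.
  rewrite lecE /= eqxx /=; apply: le_trans (Bub _ Aa); move: (A_ge0 _ Aa).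
  by rewrite lecE => /andP[].
exists (sup B)%:C%C; split=> [x Ax|y yA].
  by rewrite leRe//; [exact: Bub|exact: A_ge0].
rewrite leRe//; last exact: ub_ge0.
apply: ge_sup (proj1 hB) _ => _ [x Ax <-].
by rewrite -leRe; [exact: yA|exact: A_ge0|exact: ub_ge0].
Qed.

Section ContinuousExtension.
Context {F : numFieldType}.

(* When [A] has no supremum, [supremum 0 A] is the default value [0]. *)
Lemma supremum0_le (A : set F) (c : F) :
  0 <= c -> ubound A c -> supremum 0 A <= c.
Proof.
rewrite /supremum => c0 Ac; case: ifP => // _.
by case: xgetP => // x _ [_]; apply.
Qed.

(** Completeness gives [xget] a supremum to pick, which rules out the default value [0]. *)
Lemma supremum0_ub (A : set F) (x : F) : nneg_sup_complete F ->
  (forall y, A y -> 0 <= y) -> ubound A !=set0 -> A x -> x <= supremum 0 A.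
Proof.
move=> Fsup A_ge0 bA Ax; rewrite /supremum ifF; last first.
  by apply/negbTE/set0P; exists x.
have [|s ss] := Fsup A _ A_ge0 bA; first by exists x.
by case: xgetP => [y _ [+ _]|/(_ s)]; [exact|].
Qed.

Lemma opnorm_le (V W : normedModType F) (f : boundedOperatorType V W) (c : F) :
  0 <= c -> (forall x, `|f x| <= c * `|x|) -> opnorm f <= c.
Proof.
move=> c0 fc; apply: supremum0_le => // _ [x /= x1 <-].
by rewrite (le_trans (fc x))// ler_piMr.
Qed.

(** Continuity yields a Lipschitz constant [r], which bounds the values on the unit ball, so
    [opnorm f] is a true supremum. *)
Lemma le_opnorm (V W : normedModType F) (f : boundedOperatorType V W) (x : V) :
  nneg_sup_complete F -> `|x| <= 1 -> `|f x| <= opnorm f.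
Proof.
move=> Fsup x1; apply: supremum0_ub => //; last by exists x.
  by move=> _ [y _ <-].
have /linear_boundedP/pinfty_ex_gt0[r r0 fr] : bounded_near f (nbhs (0 : V)).
  by apply/linear_bounded_continuous; exact: cts_fun.
exists r => _ [y /= y1 <-]; rewrite (le_trans (fr y))//.
by rewrite ler_piMr// ltW.
Qed.

Lemma opnorm_bound (V W : normedModType F) (f : boundedOperatorType V W)
  (x : V) : nneg_sup_complete F -> `|f x| <= opnorm f * `|x|.
Proof.
move=> Fsup; have [->|x0] := eqVneq x 0; first by rewrite linear0 !normr0 mulr0.
have nx0 : 0 < `|x| by rewrite normr_gt0.
rewrite -ler_pdivrMr//.
have -> : `|f x| / `|x| = `|f (`|x|^-1 *: x)|.
  by rewrite linearZ normrZ mulrC gtr0_norm// invr_gt0.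
by apply: le_opnorm => //; rewrite normrZ gtr0_norm ?invr_gt0// mulVf ?gt_eqF.
Qed.

Definition mk_bounded_operator (V W : normedModType F) (f : V -> W)
    (f_lin : linear f) (f_cts : continuous f) : boundedOperatorType V W :=
  HB.pack f (GRing.isLinear.Build F V W *:%R f f_lin)
    (isContinuous.Build V W f f_cts).

Lemma lipschitz_linear_continuous (V W : normedModType F) (f : V -> W) (c : F) :
  linear f -> 0 <= c -> (forall x, `|f x| <= c * `|x|) -> continuous f.
Proof.
move=> f_lin c0 fc.
pose g : {linear V -> W} := HB.pack f (GRing.isLinear.Build F V W *:%R f f_lin).
apply: (@bounded_linear_continuous _ _ _ g); apply/linear_boundedP.
exists c; split; first exact: ger0_real.
by move=> r cr x; rewrite (le_trans (fc x))// ler_wpM2r// ltW.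
Qed.

Lemma compact_cfun_bounded (K : topologicalType) (f : cfun K F) :
  compact [set: K] -> exists M : F, forall t, `|f t| <= M.
Proof.
move=> /compact_near_coveringP Kc.
have : \forall M \near +oo, [set: K] `<=` ([set t | `|f t| <= M]).
  (* Where [f] differs from [f t] by less than 1, every [M] above [|f t| + 1] is a bound; a
     neighbourhood of [+oo] needs a real threshold. *)
  apply: Kc => t _.
  exists ([set s | `|f t - f s| < 1], [set M | `|f t| + 1 < M]);
    first split=> /=.
  - by have /cvgrPdist_lt := @cts_fun _ _ f t; apply.
  - by apply: nbhs_pinfty_gt; rewrite realD ?normr_real.
  - move=> [s M] /= [st tM]; apply/ltW; apply: le_lt_trans tM.
    by rewrite -lerBlDl (le_trans (lerB_dist _ _))// distrC ltW.
by move=> /pinfty_ex_gt0[M _ fM]; exists M => t; exact: fM.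
Qed.

Section Embedding.
Context (K : topologicalType) (Y : normedModType F).
Context (j : {linear cfun K F -> Y}).
Hypothesis Fsup : nneg_sup_complete F.
Hypothesis j_isom : forall f, `|j f| = supnorm f.

Lemma embedding_norm_le (f : cfun K F) (c : F) :
  0 <= c -> (forall t, `|f t| <= c) -> `|j f| <= c.
Proof.
by move=> c0 fc; rewrite j_isom; apply: supremum0_le => // _ [t _ <-].
Qed.

Lemma le_embedding_norm (f : cfun K F) (t : K) :
  compact [set: K] -> `|f t| <= `|j f|.
Proof.
move=> Kc; rewrite j_isom; apply: supremum0_ub => //.
- by move=> _ [s _ <-].
- by have [M fM] := compact_cfun_bounded K f Kc; exists M => _ [s _ <-].
Qed.

Lemma embedding_inj : compact [set: K] -> injective j.
Proof.
move=> Kc f g fg; apply/continuousEP => t; apply/eqP; rewrite -subr_eq0.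
rewrite -normr_le0 (le_trans (le_embedding_norm (f - g) t Kc))//.
by rewrite linearB fg subrr normr0.
Qed.

(** The weak-star topology is pulled back from the product topology on [Y -> F^o], where continuity
    is checked coordinate by coordinate. *)
Lemma weak_star_continuousP (rho : K -> dual Y) :
  continuous (rho : K -> weak_star Y) <->
  forall y, continuous (fun t => rho t y : F^o).
Proof.
split=> [rho_cts y t|rho_cts].
  have ev_cts : continuous (@weak_star_eval F Y) by exact: initial_continuous.
  apply: (@continuous_comp _ _ _ (fun t => weak_star_eval (rho t))
            (fun g : {ptws Y -> F^o} => g y)).
    apply: (@continuous_comp K (weak_star Y) _ rho (@weak_star_eval F Y)).
      exact: rho_cts.
    exact: ev_cts.
  exact: proj_continuous.
apply: continuous_comp_initial => t; apply/cvg_sup => y.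
apply: (@continuous_comp_initial _ _ _ (fun g : Y -> F^o => g y)) => s.
exact: rho_cts.
Qed.

Lemma projection_of_extension :
  continuous_extension_property j ->
  exists P : boundedOperatorType Y Y, contractive_projection_onto (range j) P.
Proof.
move=> [rho [/weak_star_continuousP rho_cts rhoP]].
pose g y : cfun K F := mkcts (rho_cts y).
have g_lin : linear (j \o g).
  move=> a x y /=; rewrite -linearP; congr (j _).
  by apply/continuousEP => t; exact: (linearP (rho t)).
(* Each [rho t] has norm 1, so [|y|] bounds [|g y t|] uniformly in [t], hence also the supremum
   norm. *)
have jg_le y : `|(j \o g) y| <= 1 * `|y|.
  rewrite mul1r; apply: embedding_norm_le => // t.
  by have := opnorm_bound _ _ (rho t) y Fsup; rewrite (rhoP t).2 mul1r.
(* Since [rho t] extends the Dirac functional at [t], [j \o g] fixes [range j]; this gives both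
   idempotence and the range. *)
have jgj f : j (g (j f)) = j f.
  by congr (j _); apply/continuousEP => t; exact: (rhoP t).1.
exists (mk_bounded_operator _ _ _ g_lin
          (lipschitz_linear_continuous _ _ _ _ g_lin ler01 jg_le)).
split=> [y||]; first exact: jgj.
- apply/seteqP; split=> [_ [y _ <-]|_ [f _ <-]]; first by exists (g y).
  by exists (j f) => //; exact: jgj.
- exact: opnorm_le.
Qed.

Lemma extension_of_projection :
  compact [set: K] ->
  (exists P : boundedOperatorType Y Y,
    contractive_projection_onto (range j) P) ->
  continuous_extension_property j.
Proof.
move=> Kc [P [P_idem P_range P_le1]].
(* [g] is [P] followed by the inverse of [j] on its range; [rho t] will be [g] followed by
   evaluation at [t]. *)
have /choice[g gP] : forall y, exists f, j f = P y.
  move=> y; have : range j (P y) by rewrite -P_range; exists y.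
  by move=> [f _ <-]; exists f.
have g_lin : linear g.
  move=> a x y; apply: (embedding_inj Kc).
  by rewrite linearP !gP linearP.
(* An idempotent fixes every point of its range. *)
have gj f : g (j f) = f.
  apply: (embedding_inj Kc); rewrite gP.
  have : range P (j f) by rewrite P_range; exists f.
  by move=> [y _ <-].
pose r t y : F^o := g y t.
have r_lin t : linear (r t) by move=> a x y; rewrite /r g_lin.
have r_le t y : `|r t y| <= 1 * `|y|.
  rewrite (le_trans (le_embedding_norm _ _ Kc))// gP.
  by rewrite (le_trans (opnorm_bound _ _ _ y Fsup))// ler_wpM2r.
pose rho t : dual Y := mk_bounded_operator _ _ _ (r_lin t)
  (lipschitz_linear_continuous _ _ _ _ (r_lin t) ler01 (r_le t)).
exists rho; split; first by apply/weak_star_continuousP => y; exact: cts_fun.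
move=> t; split=> [f|]; first by rewrite /= /r gj.
apply/eqP; rewrite eq_le opnorm_le//=.
(* The lower bound on the norm: [j one] lies in the unit ball and [rho t] sends it to 1. *)
pose one : cfun K F := mkcts (@cst_continuous K F^o 1).
have j1_le1 : `|j one| <= 1.
  by apply: embedding_norm_le => // s; rewrite /= normr1.
have := le_opnorm _ _ (rho t) _ Fsup j1_le1.
by rewrite /= /r gj /= normr1.
Qed.

End Embedding.

End ContinuousExtension.

Theorem lemma2p1 (R : realType) :
  (forall (K : topologicalType) (Y : completeNormedModType R)
      (j : {linear cfun K R -> Y}),
    compact [set: K] -> hausdorff_space K -> isometric_closed_embedding j ->
    continuous_extension_property j <->
    exists P : boundedOperatorType Y Y,
      contractive_projection_onto (range j) P) /\
  (forall (K : topologicalType) (Y : completeNormedModType R[i])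
      (j : {linear cfun K R[i] -> Y}),
    compact [set: K] -> hausdorff_space K -> isometric_closed_embedding j ->
    continuous_extension_property j <->
    exists P : boundedOperatorType Y Y,
      contractive_projection_onto (range j) P).
Proof.
split=> K Y j Kc _ [j_isom _]; split.
- exact: projection_of_extension (real_nneg_sup_complete R) j_isom.
- exact: extension_of_projection (real_nneg_sup_complete R) j_isom Kc.
- exact: projection_of_extension (complex_nneg_sup_complete R) j_isom.
- exact: extension_of_projection (complex_nneg_sup_complete R) j_isom Kc.
Qed.
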